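(* Let $\lambda,\mu$ be partitions with $\lambda\subseteq\mu$. Then \[ C_{\lambda,\mu}(\boldsymbol\alpha,\boldsymbol\beta)=\sum_{T\in \mathrm{IET}_{\mathbb Z}(\mu/\lambda)}\ \prod_{(i,j)\in\mu/\lambda}\big(\alpha_{T(i,j)}-\beta_{T(i,j)-c(i,j)}\big), \] where $\alpha_m=\beta_m=0$ for $m\le0$. In particular, $G_\lambda(\mathbf x;\boldsymbol\alpha,-\boldsymbol\beta)$ is Schur-positive, that is, $C_{\lambda,\mu}(\boldsymbol\alpha,-\boldsymbol\beta)$ is a polynomial in $\boldsymbol\alpha,\boldsymbol\beta$ with nonnegative integer coefficients.
   Context: Parameters $\boldsymbol\alpha=(\alpha_1,\alpha_2,\dots)$, $\boldsymbol\beta=(\beta_1,\beta_2,\dots)$; $-\boldsymbol\beta=(-\beta_1,-\beta_2,\dots)$. $A_k=\alpha_1+\dots+\alpha_k$, $B_k=\beta_1+\dots+\beta_k$ for $k\ge1$, $A_k=B_k=0$ for $k\le 0$. For a formal $\mathbb Z$-linear combination $Z=\sum_uc_uu$ of parameters, $\sum_{m\ge0}h_m[Z]t^m=\prod_u(1-ut)^{-c_u}$ and $h_m[Z]=0$ for $m<0$. For partitions $\lambda,\mu$ with at most $n$ parts, $C_{\lambda,\mu}(\boldsymbol\alpha,\boldsymbol\beta)=\det\big(h_{\mu_i-\lambda_j-i+j}[A_{\lambda_j}-B_{j-1}]\big)_{i,j=1}^n$ (independent of $n\ge\max(\ell(\lambda),\ell(\mu))$); these are the coefficients in the Schur expansion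 $G_\lambda(\mathbf x;\boldsymbol\alpha,\boldsymbol\beta)=\sum_{\mu\supseteq\lambda}C_{\lambda,\mu}(\boldsymbol\alpha,\boldsymbol\beta)s_\mu(\mathbf x)$ of the refined canonical stable Grothendieck polynomial $G_\lambda(\mathbf x;\boldsymbol\alpha,\boldsymbol\beta)$, i.e. the formal power series whose restriction to $x_1,\dots,x_n$ (others set to $0$) is $\det\big(x_j^{\lambda_i+n-i}\prod_{k=1}^{i-1}(1-\beta_kx_j)/\prod_{k=1}^{\lambda_i}(1-\alpha_kx_j)\big)_{i,j=1}^n/\prod_{i<j}(x_i-x_j)$ for each $n\ge\ell(\lambda)$. ''Schur-positive'' means all Schur coefficients are polynomials with nonnegative integer coefficients. Cells of a skew shape $\mu/\lambda$ are pairs $(i,j)$ with $\lambda_i<j\le\mu_i$ (matrix coordinates), and the content is $c(i,j)=j-i$. A $\mathbb Z$-inelegant tableau of shape $\mu/\lambda$ is a filling $T$ of the cells of $\mu/\lambda$ with integers such that rows are weakly decreasing left to right, columns are strictly decreasing top to bottom, and $\min(j-i,0)<T(i,j)<j$ for all $(i,j)\in\mu/\lambda$ (equivalently $\min(\mu_i-i,0)<T(i,j)\le\lambda_i$). $\mathrm{IET}_{\mathbb Z}(\mu/\lambda)$ is the set of these. *)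

(* Defs.v *)
From mathcomp Require Import all_boot all_order all_fingroup all_algebra.
From mathcomp Require Import finmap.
From mathcomp.multinomials Require Import monalg.

Set Implicit Arguments.
Unset Strict Implicit.
Unset Printing Implicit Defensive.

Import Order.TTheory GRing.Theory Num.Theory.

Local Open Scope fset_scope.
Local Open Scope ring_scope.

(** ** Partitions *)

Definition is_part (s : seq nat) : bool := sorted geq s && (0%N \notin s).

Definition ptn : Type := {s : seq nat | is_part s}.

Definition ell (la : ptn) : nat := size (val la).

(* Parts are indexed from 0: [part la i] is lambda_{i+1}, and it is 0 beyond
   the length. *)
Definition part (la : ptn) (i : nat) : nat := nth 0%N (val la) i.

Definition ptn_sub (la mu : ptn) : Prop := forall i, (part la i <= part mu i)%N.

(** ** The coefficients h_m[Z] *)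

Section Pleth.
Variable R : comNzRingType.

(* A formal power series in one variable t is its coefficient sequence. *)
Definition ser_one : nat -> R := fun d => (d == 0%N)%:R.

Definition ser_mul (f g : nat -> R) : nat -> R :=
  fun d => \sum_(i < d.+1) f i * g (d - i)%N.

(* (1 - u t)^-1 and 1 - u t *)
Definition ser_geom (u : R) : nat -> R := fun d => u ^+ d.
Definition ser_lin (u : R) : nat -> R :=
  fun d => (d == 0%N)%:R - u *+ (d == 1%N).

(* [pleth Z] is the product of (1 - u t)^(-c) over the entries (c, u) of Z,
   which stands for the formal linear combination sum_(c, u) c u. *)
Definition pleth (Z : seq (int * R)) : nat -> R :=
  foldr (fun cu : int * R =>
           iter `|cu.1|%N
             (ser_mul (if 0 <= cu.1 then ser_geom cu.2 else ser_lin cu.2)))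
        ser_one Z.

Definition hpleth (m : int) (Z : seq (int * R)) : R :=
  if 0 <= m then pleth Z `|m|%N else 0.

(* Parameter sequences are functions on nat whose value at 0 is never used:
   [al k] is alpha_k for k >= 1.  [AmB al be k l] is A_k - B_l. *)
Definition AmB (al be : nat -> R) (k l : nat) : seq (int * R) :=
  [seq (1, al i) | i <- iota 1 k] ++ [seq (-1, be i) | i <- iota 1 l].

(* With rows and columns numbered from 0 the index j - 1 of B becomes j. *)
Definition Ccoef (n : nat) (la mu : ptn) (al be : nat -> R) : R :=
  \det (\matrix_(i < n, j < n)
          hpleth ((part mu i)%:Z - (part la j)%:Z - i%:Z + j%:Z)
                 (AmB al be (part la j) j)).

(* The convention alpha_m = beta_m = 0 for m <= 0. *)
Definition ext0 (al : nat -> R) (m : int) : R :=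
  if 0 < m then al `|m|%N else 0.

End Pleth.

(** ** Z-inelegant tableaux *)

Section Tableaux.
Variables la mu : ptn.

(* Cells are stored with coordinates numbered from 0; [crow] and [ccol] are
   the usual matrix coordinates, numbered from 1. *)
Definition cell : Type :=
  {c : 'I_(ell mu) * 'I_(part mu 0) | (part la c.1 <= c.2 < part mu c.1)%N}.

Definition crow (c : cell) : nat := (val c).1.+1.
Definition ccol (c : cell) : nat := (val c).2.+1.

Definition content (c : cell) : int := (ccol c)%:Z - (crow c)%:Z.

Definition is_IET (T : {ffun cell -> int}) : bool :=
  [&& [forall c, forall d,
         (crow c == crow d) && (ccol c <= ccol d)%N ==> (T d <= T c)],
      [forall c, forall d,
         (ccol c == ccol d) && (crow c < crow d)%N ==> (T d < T c)] &
      [forall c, Num.min (content c) 0 < T c < (ccol c)%:Z]].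

(* Entries of an inelegant tableau lie between - ell mu and mu_1; the fillings
   with values in that range are enumerated to obtain the finite set of all
   inelegant tableaux (see [in_IET]). *)
Definition shift_fill
    (t : {ffun cell -> 'I_(ell mu + part mu 0)}) : {ffun cell -> int} :=
  [ffun c => (t c : nat)%:Z - (ell mu)%:Z].

Definition IET : {fset {ffun cell -> int}} :=
  [fset T in [seq T <- codom shift_fill | is_IET T]].

Lemma in_IET (T : {ffun cell -> int}) : (T \in IET) = is_IET T.
Proof.
rewrite inE /= mem_filter; case HT: (is_IET T) => //=.
case/and3P: HT => _ _ /forallP H.
have Hb c : (absz (T c + (ell mu)%:Z)%R < ell mu + part mu 0)%N /\
            0 <= T c + (ell mu)%:Z.
  case/andP: (H c) => H1 H2.
  have c1 : (crow c <= ell mu)%N by exact: ltn_ord.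
  have c2 : (ccol c <= part mu 0)%N by exact: ltn_ord.
  have H3 : - (ell mu)%:Z < T c.
    apply: le_lt_trans H1.
    rewrite le_min oppr_le0 andbT // /content.
    rewrite lerNl opprB lerBlDr -PoszD lez_nat.
    exact: leq_trans c1 (leq_addr _ _).
  have H4 : 0 <= T c + (ell mu)%:Z by rewrite -lerBlDr sub0r ltW.
  split=> //; rewrite -ltz_nat gez0_abs // PoszD addrC ltrD2l.
  by apply: lt_le_trans H2 _; rewrite lez_nat.
apply/codomP; exists [ffun c => Ordinal (proj1 (Hb c))].
apply/ffunP => c; rewrite !ffunE /= gez0_abs ?addrK //.
exact: (proj2 (Hb c)).
Qed.

End Tableaux.

Definition IET_sum (R : comNzRingType) (la mu : ptn) (al be : nat -> R) : R :=
  \sum_(T <- IET la mu)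
    \prod_(c : cell la mu) (ext0 al (T c) - ext0 be (T c - content c)).

(** ** The parameter ring Z[alpha_1, alpha_2, ..., beta_1, beta_2, ...] *)

Definition params : comNzRingType := {malg int[{cmonom (bool * nat)%type}]}.

Definition alpha (k : nat) : params := << @ucm (bool * nat)%type (false, k) >>.
Definition beta (k : nat) : params := << @ucm (bool * nat)%type (true, k) >>.
Definition minus_beta (k : nat) : params := - beta k.

Definition nonneg_coefs (p : {malg int[{cmonom (bool * nat)%type}]}) : Prop :=
  forall m : {cmonom (bool * nat)%type}, 0 <= p@_m.

(** ** Formal power series in x_1, x_2, ... *)

(* A series is its function of coefficients.  The variables are numbered from
   0: the exponent of x_{j+1} in the monomial m is [m j]. *)
Definition series : Type := {cmonom nat} -> params.

(* Set x_{n+1} = x_{n+2} = ... = 0. *)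
Definition restrict (n : nat) (g : series) : series :=
  fun m => if all (fun j => (j < n)%N) (finsupp m) then g m else 0.

(* Product of a polynomial and a series; as [divcm] truncates, the condition
   says that the monomial k divides m. *)
Definition poly_mul (p : {malg params[{cmonom nat}]}) (g : series) : series :=
  fun m => \sum_(k <- msupp p | mulcm k (divcm m k) == m)
             p@_k * g (divcm m k).

Definition vandermonde (n : nat) : {malg params[{cmonom nat}]} :=
  \prod_(i < n) \prod_(j < n | (i < j)%N)
     (<< @ucm nat i >> - << @ucm nat j >>).

(* det (f_i(x_j)), for series f_i in one variable: by the Leibniz formula its
   coefficient at a monomial m in the first n variables is
   det ([t^(m_j)] f_i(t)). *)
Definition alternant (n : nat) (f : nat -> nat -> params) : series :=
  restrict n (fun m => \det (\matrix_(i < n, j < n) f i (m (j : nat)))).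

(* g is the series whose restriction to x_1, ..., x_n is
   det (f_{n,i}(x_j)) / prod_(i < j) (x_i - x_j) for all n >= n0. *)
Definition is_bialternant (n0 : nat) (f : nat -> nat -> nat -> params)
    (g : series) : Prop :=
  forall n, (n0 <= n)%N ->
    poly_mul (vandermonde n) (restrict n g) =1 alternant n (f n).

(* t^(la_i + n - i) prod_(k < i) (1 - be_k t) / prod_(k <= la_i) (1 - al_k t)
   for the row of index i + 1 in place of i. *)
Definition G_row (la : ptn) (al be : nat -> params) (n i d : nat) : params :=
  hpleth (d%:Z - (part la i + (n - i.+1))%:Z) (AmB al be (part la i) i).

Definition is_G (la : ptn) (al be : nat -> params) : series -> Prop :=
  is_bialternant (ell la) (G_row la al be).

(* t^(mu_i + n - i) *)
Definition schur_row (mu : ptn) (n i d : nat) : params :=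
  (d == part mu i + (n - i.+1))%N%:R.

Definition is_schur (mu : ptn) : series -> Prop :=
  is_bialternant (ell mu) (schur_row mu).

(* g is the (possibly infinite) sum of the c mu * s mu: at each monomial, all
   large enough finite partial sums agree with g. *)
Definition is_expansion (s : ptn -> series) (c : ptn -> params) (g : series) :
    Prop :=
  forall m : {cmonom nat}, exists S : {fset ptn},
    forall S' : {fset ptn}, S `<=` S' ->
      \sum_(mu <- S') c mu * s mu m = g m.

(* [s] is meant to be the family of Schur functions. *)
Definition schur_positive (s : ptn -> series) (g : series) : Prop :=
  exists c : ptn -> params,
    is_expansion s c g /\ forall mu, nonneg_coefs (c mu).

(* Main.v *)
(* The entry h_m[A_a - B_b] is the weight of all lattice paths that use one level
   per entry value, a horizontal step at entry t into content c having weight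
   alpha_t - beta_(t-c): both sides satisfy the same recursion on the top level.
   Hence C_(la,mu) is a Lindstrom-Gessel-Viennot determinant, and expanding it
   multilinearly, one step of one path at a time, is the same as removing the
   largest entries of a tableau one cell at a time; two paths that meet give two
   equal columns.
   For the Schur expansion, the coefficient of a monomial in the bialternant
   numerator of G_la is, up to the sign of the sorting permutation, the
   determinant C_(la,nu), where nu + delta is the sorted exponent vector; the
   Vandermonde factor is cancelled one binomial x_i - x_j at a time. *)
Require Import Defs.
From mathcomp Require Import all_boot all_order all_fingroup all_algebra.
From mathcomp Require Import finmap ring zify.
From mathcomp.multinomials Require Import monalg.

Set Implicit Arguments.
Unset Strict Implicit.
Unset Printing Implicit Defensive.

Import Order.TTheory GRing.Theory Num.Theory.

Local Open Scope ring_scope.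

(** * Lattice path sums *)

Section Series.
Variable R : comNzRingType.
Implicit Types (f g h e : nat -> R) (u : R) (Z : seq (int * R)).

(* f = g + u t h *)
Definition ser_step u f g h := f 0%N = g 0%N /\ forall d, f d.+1 = g d.+1 + u * h d.

(** Multiplication by a fixed series is linear, so a relation produced by one factor survives the
    factors to its left in [pleth]. *)
Lemma ser_mul_step u f g h e :
  ser_step u f g h -> ser_step u (ser_mul e f) (ser_mul e g) (ser_mul e h).
Proof.
move=> [f0 fS]; split=> [|d]; rewrite /ser_mul.
  by rewrite !big_ord_recl !big_ord0 /= f0.
rewrite big_ord_recr [in RHS]big_ord_recr /= subnn f0 mulr_sumr addrAC.
congr (_ + _); rewrite -big_split; apply: eq_bigr => i _ /=.
by rewrite subSn ?fS; [ring | rewrite -ltnS].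
Qed.

Lemma ser_mul_geom_step u f : ser_step u (ser_mul (ser_geom u) f) f (ser_mul (ser_geom u) f).
Proof.
split=> [|d]; first by rewrite /ser_mul big_ord_recl big_ord0 /= /ser_geom expr0 mul1r addr0.
rewrite /ser_mul big_ord_recl /ser_geom expr0 mul1r subn0; congr (_ + _).
by rewrite mulr_sumr; apply: eq_bigr => i _; rewrite /= exprS mulrA.
Qed.

Lemma ser_mul_lin_step u f : ser_step (- u) (ser_mul (ser_lin u) f) f f.
Proof.
split=> [|d].
  by rewrite /ser_mul big_ord_recl big_ord0 /= /ser_lin /= !mulr0n subr0 mul1r addr0.
rewrite /ser_mul 2!big_ord_recl big1 => [|i _]; last first.
  by rewrite /ser_lin /= /bump /= !mulr0n subr0 mul0r.
by rewrite /ser_lin /= !mulr0n ?mulr1n subr0 mul1r sub0r addr0 subn0 subn1.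
Qed.

(** The new factor sits inside the list because [AmB] puts the next alpha before all the betas. *)
Lemma pleth_geom_step Z1 Z2 u :
  ser_step u (pleth (Z1 ++ (1, u) :: Z2)) (pleth (Z1 ++ Z2)) (pleth (Z1 ++ (1, u) :: Z2)).
Proof.
elim: Z1 => [|[c v] Z1 IH] /=; first exact: ser_mul_geom_step.
by elim: `|c|%N => //= k IHk; apply: ser_mul_step.
Qed.

Lemma pleth_lin_step Z1 Z2 u :
  ser_step (- u) (pleth (Z1 ++ (-1, u) :: Z2)) (pleth (Z1 ++ Z2)) (pleth (Z1 ++ Z2)).
Proof.
elim: Z1 => [|[c v] Z1 IH] /=; first exact: ser_mul_lin_step.
by elim: `|c|%N => //= k IHk; apply: ser_mul_step.
Qed.

Variables al be : nat -> R.

Lemma pleth_AmB_succ_l a b :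
  ser_step (al a.+1) (pleth (AmB al be a.+1 b)) (pleth (AmB al be a b))
    (pleth (AmB al be a.+1 b)).
Proof.
have -> : AmB al be a.+1 b =
    [seq (1, al i) | i <- iota 1 a] ++ (1, al a.+1) :: [seq (-1, be i) | i <- iota 1 b].
  by rewrite /AmB -[in LHS](addn1 a) iotaD map_cat -catA /= add1n.
exact: pleth_geom_step.
Qed.

Lemma pleth_AmB_succ_r a b :
  ser_step (- be b.+1) (pleth (AmB al be a b.+1)) (pleth (AmB al be a b))
    (pleth (AmB al be a b)).
Proof.
have -> : AmB al be a b.+1 = AmB al be a b ++ (-1, be b.+1) :: [::].
  by rewrite /AmB -[in LHS](addn1 b) iotaD map_cat catA /= add1n.
by have := pleth_lin_step (AmB al be a b) [::] (be b.+1); rewrite cats0.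
Qed.

End Series.

(* Lattice paths live on shifted coordinates: the level t stands for the entry
   t - n and the position p for the content p - n, so that both are natural
   numbers; truncated subtraction matches A_k = B_k = 0 for k <= 0. *)
Section Paths.
Variables (R : comNzRingType) (al be : nat -> R) (n : nat).

Definition step_weight (t p : nat) : R :=
  ext0 al (t%:Z - n%:Z) - ext0 be (t%:Z - p%:Z).

(** Along a path the position rises from p to q while the level falls from t. B stops at t - p - 1,
    the beta index of a step at level t into p + 1. *)
Definition path_sum (t p q : nat) : R :=
  hpleth (q%:Z - p%:Z) (AmB al be (t - n) (t - p.+1)).

Lemma path_sum_gt t p q : (q < p)%N -> path_sum t p q = 0.
Proof. by move=> qp; rewrite /path_sum /hpleth ifF //; lia. Qed.

Lemma path_sum0 p q : path_sum 0 p q = (p == q)%:R.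
Proof.
rewrite /path_sum /hpleth !sub0n /AmB /= /ser_one.
case: ifP => h; last by have -> : p == q = false by lia.
by congr (_%:R); lia.
Qed.

(** A path either steps into p + 1 at level t + 1 or drops to level t. Algebraically, [f1] arises
    from [f3] by one new alpha and one new beta; [f2], with the alpha alone, is the alphabet for a
    start at p + 1, so both corrections are multiples of its series. If an index is not positive,
    list and weight both omit that parameter. *)
Lemma path_sum_succ t p q :
  path_sum t.+1 p q =
    step_weight t.+1 p.+1 * path_sum t.+1 p.+1 q + path_sum t p q.
Proof.
have [qp|pq] := ltnP q p.
  by rewrite !path_sum_gt ?mulr0 ?addr0 //; lia.
set f1 := AmB al be (t.+1 - n) (t - p).
set f2 := AmB al be (t.+1 - n) (t - p.+1).
set f3 := AmB al be (t - n) (t - p.+1).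
have s1 : ser_step (- ext0 be (t%:Z - p%:Z)) (pleth f1) (pleth f2) (pleth f2).
  rewrite /f1 /f2 /ext0; case: (ltnP p t) => pt.
    have -> : (t - p = (t - p.+1).+1)%N by lia.
    rewrite ifT; last by lia.
    have -> : (`|t%:Z - p%:Z| = (t - p.+1).+1)%N by lia.
    exact: pleth_AmB_succ_r.
  have -> : (t - p.+1 = t - p)%N by lia.
  rewrite ifF; last by lia.
  by split=> // d; rewrite oppr0 mul0r addr0.
have s2 : ser_step (ext0 al (t.+1%:Z - n%:Z)) (pleth f2) (pleth f3) (pleth f2).
  rewrite /f2 /f3 /ext0; case: (leqP n t) => nt.
    have -> : (t.+1 - n = (t - n).+1)%N by lia.
    rewrite ifT; last by lia.
    have -> : (`|t.+1%:Z - n%:Z| = (t - n).+1)%N by lia.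
    exact: pleth_AmB_succ_l.
  have -> : (t.+1 - n = t - n)%N by lia.
  rewrite ifF; last by lia.
  by split=> // d; rewrite mul0r addr0.
rewrite /path_sum /step_weight !subSS -/f1 -/f2 -/f3.
have -> : t.+1%:Z - p.+1%:Z = t%:Z - p%:Z by lia.
rewrite /hpleth.
rewrite [in X in X = _]ifT; last by lia.
rewrite [in X in _ = _ + X]ifT; last by lia.
have [->|npq] := eqVneq q p.
  rewrite ifF ?mulr0 ?add0r; last by lia.
  by rewrite subrr /= s1.1 s2.1.
rewrite ifT; last by lia.
have -> : (`|q%:Z - p%:Z| = `|q%:Z - p.+1%:Z|.+1)%N by lia.
by rewrite s1.2 s2.2; ring.
Qed.

End Paths.

(** * Determinants and tableaux *)

Lemma part_nonincr (la : ptn) i j : (i <= j)%N -> (part la j <= part la i)%N.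
Proof.
case/andP: (valP la) => s_sorted _ ij; rewrite /part.
have [js|js] := ltnP j (size (val la)); last by rewrite nth_default.
have tr : transitive geq by move=> a b c /= ba ac; apply: leq_trans ba.
by apply: (sorted_leq_nth tr (leqnn : reflexive geq) 0%N s_sorted) => //; apply: leq_ltn_trans js.
Qed.

Lemma part_default (la : ptn) i : (ell la <= i)%N -> part la i = 0%N.
Proof. exact: nth_default. Qed.

Lemma part_ell_gt0 (la : ptn) i : (i < ell la)%N -> (0 < part la i)%N.
Proof.
rewrite /ell /part => lt_i; case/andP: (valP la) => _.
by apply: contraR; rewrite -eqn0Ngt => /eqP <-; apply: mem_nth.
Qed.

Lemma ptn_subP (la mu : ptn) :
  reflect (ptn_sub la mu) [forall i : 'I_(ell la), part la i <= part mu i]%N.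
Proof.
apply: (iffP forallP) => [sub i|sub i]; last exact: sub.
have [i_la|la_i] := ltnP i (ell la); first exact: (sub (Ordinal i_la)).
by rewrite part_default.
Qed.

Lemma card_ord_lt n k : (k <= n)%N -> #|[set j : 'I_n | (j < k)%N]| = k.
Proof.
move=> kn; rewrite -sum1_card (eq_bigl (fun j : 'I_n => j < k)%N) => [|j]; last by rewrite inE.
by rewrite (big_ord_narrow kn) sum1_card card_ord.
Qed.

(* A zero block of r + 1 rows and n - r columns leaves no room for a permutation. *)
Lemma det_zero_block (R : comNzRingType) n (M : 'M[R]_n) (r : nat) : (r < n)%N ->
  (forall i j : 'I_n, (i <= r)%N -> (r <= j)%N -> M i j = 0) -> \det M = 0.
Proof.
move=> rn M0; rewrite /determinant big1 // => s _.
have [i ir sir] : exists2 i : 'I_n, (i <= r)%N & (r <= s i)%N.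
  apply/exists_inP; apply: contraLR (leqnn r.+1) => /exists_inPn Hs.
  rewrite -ltnNge ltnS -[X in (X <= _)%N](card_ord_lt rn) -[X in (_ <= X)%N](card_ord_lt (ltnW rn)).
  rewrite -(card_imset _ (@perm_inj _ s)); apply/subset_leq_card/subsetP.
  move=> _ /imsetP[i + ->]; rewrite !inE ltnS => ir.
  by rewrite ltnNge Hs.
by rewrite (bigD1 i) //= M0 // mul0r mulr0.
Qed.

Section Tableaux.
Variables (la mu : ptn) (n : nat).
Variables (R : comNzRingType) (al be : nat -> R).

Local Notation cell := (cell la mu).
Local Notation filling := {ffun cell -> 'I_(n + part mu 0).+1}.
Implicit Types (nu b : nat -> nat) (T : filling) (c d : cell).

Definition cell_row c : nat := (val c).1.
Definition cell_col c : nat := (val c).2.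

Lemma cell_inj c d : cell_row c = cell_row d -> cell_col c = cell_col d -> c = d.
Proof.
case: c d => [[i j] p] [[i' j'] p']; rewrite /cell_row /cell_col /= => e1 e2.
by apply: val_inj; congr (_, _); apply: val_inj.
Qed.

Lemma cellP c : (part la (cell_row c) <= cell_col c < part mu (cell_row c))%N.
Proof. exact: (valP c). Qed.

Lemma row_lt c : (cell_row c < ell mu)%N. Proof. exact: ltn_ord. Qed.

Lemma cell_ex i j : (part la i <= j < part mu i)%N ->
  exists2 c : cell, cell_row c = i & cell_col c = j.
Proof.
move=> ij; have im : (i < ell mu)%N.
  by rewrite ltnNge; apply/negP => /part_default mu0; lia.
have jm : (j < part mu 0)%N by have := part_nonincr mu (leq0n i); lia.
by exists (Sub (Ordinal im, Ordinal jm) ij : cell).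
Qed.

Definition outside nu c := (nu (cell_row c) <= cell_col c)%N.

(* Fillings of mu/nu as fillings of mu/la that vanish on nu/la. *)
Definition valid nu b T :=
  [&& [forall c, if outside nu c then 0 < T c <= b (cell_row c) else T c == 0 :> nat],
      [forall c, forall d, [&& outside nu c, outside nu d, cell_row c == cell_row d &
         cell_col c <= cell_col d] ==> (T d <= T c)] &
      [forall c, forall d, [&& outside nu c, outside nu d, cell_col c == cell_col d &
         cell_row c < cell_row d] ==> (T d < T c)]]%N.

Lemma validP nu b T : reflect
  [/\ forall c, outside nu c -> (0 < T c <= b (cell_row c))%N,
      forall c, ~~ outside nu c -> T c = 0%N :> nat,
      forall c d, outside nu c -> outside nu d -> cell_row c = cell_row d ->
        (cell_col c <= cell_col d)%N -> (T d <= T c)%N &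
      forall c d, outside nu c -> outside nu d -> cell_col c = cell_col d ->
        (cell_row c < cell_row d)%N -> (T d < T c)%N]
  (valid nu b T).
Proof.
apply: (iffP and3P) => [[/forallP h1 /forallP h2 /forallP h3]|[h1 h2 h3 h4]]; split.
- by move=> c oc; have := h1 c; rewrite oc.
- by move=> c /negbTE oc; have := h1 c; rewrite oc => /eqP.
- move=> c d oc od /eqP e le; have /forallP/(_ d)/implyP := h2 c.
  by apply; rewrite oc od e le.
- move=> c d oc od /eqP e le; have /forallP/(_ d)/implyP := h3 c.
  by apply; rewrite oc od e le.
- by apply/forallP => c; case: ifPn => oc; [apply: h1 | apply/eqP/h2].
- apply/forallP => c; apply/forallP => d; apply/implyP => /and4P[? ? /eqP ? ?].
  exact: h3.
- apply/forallP => c; apply/forallP => d; apply/implyP => /and4P[? ? /eqP ? ?].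
  exact: h4.
Qed.

Definition cell_weight T c : R := step_weight al be n (T c) (cell_col c + n - cell_row c).

Definition tab_sum nu b : R :=
  \sum_(T : filling | valid nu b T) \prod_(c | outside nu c) cell_weight T c.

(** Rows are starts, columns are ends. Path j starts at the shifted content just left of the first
    cell of mu/nu in row j; if it ends in its own row, it steps into the contents of exactly those
    cells. *)
Definition path_det nu b : R :=
  \det (\matrix_(j < n, i < n)
     path_sum al be n (b j) (nu j + (n - j.+1)) (part mu i + (n - i.+1))).

Lemma tab_sum_eq nu b b' : (forall c, outside nu c -> b (cell_row c) = b' (cell_row c)) ->
  tab_sum nu b = tab_sum nu b'.
Proof.
move=> bb; apply: eq_bigl => T; rewrite /valid; congr [&& _ , _ & _].
by apply: eq_forallb => c; case: ifP => // /bb ->.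
Qed.

Lemma path_det_eq nu b b' : (forall i, (i < n)%N -> b i = b' i) ->
  path_det nu b = path_det nu b'.
Proof. by move=> bb; congr (\det _); apply/matrixP => j i; rewrite !mxE bb. Qed.

Definition add_cell nu r : nat -> nat := fun i => (nu i + (i == r))%N.

Lemma outside_add_cell nu r c0 c : cell_row c0 = r -> cell_col c0 = nu r ->
  outside (add_cell nu r) c = outside nu c && (c != c0).
Proof.
move=> r0 col0; rewrite /outside /add_cell.
have [->|nc] := eqVneq c c0; first by rewrite r0 eqxx; lia.
rewrite andbT; have [e|_] := eqVneq (cell_row c) r; last by rewrite addn0.
suff: cell_col c != nu r by rewrite e; lia.
by apply: contra nc => /eqP e'; apply/eqP/cell_inj; rewrite ?e ?e'.
Qed.

(** * Removing one cell with the largest entry *)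

Section Peel.
Variables (nu b b' : nat -> nat) (r t : nat) (c0 : cell).
Hypotheses (nu_dec : forall i j, (i <= j)%N -> (nu j <= nu i)%N)
  (la_nu : forall i, (part la i <= nu i)%N) (row0 : cell_row c0 = r)
  (col0 : cell_col c0 = nu r) (t_lt : (t.+1 <= n + part mu 0)%N)
  (br : b r = t) (b'r : b' r = t.+1) (bb' : forall i, i != r -> b i = b' i)
  (b'_le : forall i, (b' i <= t.+1)%N) (b'_lt : forall i, (r < i)%N -> (b' i <= t)%N).

Let out0 : outside nu c0. Proof. by rewrite /outside row0 col0. Qed.

(** The first cell [c0] of mu/nu in row r carries the largest entry of that row; if this is not t +
    1, the whole row stays within t. *)
Lemma valid_lower T : valid nu b' T && (T c0 != t.+1 :> nat) = valid nu b T.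
Proof.
apply/andP/idP => [[/validP[h1 h2 h3 h4] ne]|/validP[h1 h2 h3 h4]].
  apply/validP; split=> // c oc; have [e|ne'] := eqVneq (cell_row c) r; last by rewrite bb' // h1.
  have := h3 c0 c out0 oc; rewrite row0 e col0 => /(_ erefl).
  have := oc; rewrite /outside e => -> /(_ isT).
  by have := h1 _ oc; have := h1 _ out0; rewrite row0 e br b'r; lia.
split; last by have := h1 _ out0; rewrite row0 br; lia.
apply/validP; split=> // c oc; have := h1 _ oc.
by have [->|ne'] := eqVneq (cell_row c) r; [rewrite br b'r; lia | rewrite bb'].
Qed.

Definition put T (v : nat) : filling := [ffun c => if c == c0 then inord v else T c].

(** An entry t + 1 at [c0] constrains nothing else: to its right the bound is t + 1, below it the
    bound is t, and above it the column lies inside nu. The second conjunct says that T vanishes at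
    [c0], in the form produced by [reindex_onto]. *)
Lemma valid_raise T : (r = 0 \/ nu r < nu r.-1)%N ->
  valid nu b' (put T t.+1) && (put (put T t.+1) 0 == T) = valid (add_cell nu r) b' T.
Proof.
move=> nu_r; have Ec : put T t.+1 c0 = t.+1 :> nat by rewrite ffunE eqxx inordK.
have Ed d : d != c0 -> put T t.+1 d = T d by rewrite ffunE => /negbTE ->.
have out d := outside_add_cell d row0 col0.
have above d : outside nu d -> cell_col d = cell_col c0 -> (cell_row d < cell_row c0)%N -> False.
  rewrite /outside row0 => od e lt; case: nu_r => [r0|nu_r]; first by lia.
  by have : (nu r.-1 <= nu (cell_row d))%N by [apply: nu_dec; lia]; lia.
apply/andP/validP => [[/validP[h1 h2 h3 h4] /eqP E]|[h1 h2 h3 h4]]; split.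
- by move=> c; rewrite out => /andP[oc /Ed <-]; apply: h1.
- move=> c; rewrite out negb_and negbK; have [->|nc] := eqVneq c c0.
    by rewrite -E ffunE eqxx inordK.
  by rewrite orbF => /h2; rewrite Ed.
- by move=> c d; rewrite !out => /andP[oc /Ed <-] /andP[od /Ed <-]; apply: h3.
- by move=> c d; rewrite !out => /andP[oc /Ed <-] /andP[od /Ed <-]; apply: h4.
- apply/validP; split.
  + move=> c oc; have [->|nc] := eqVneq c c0; first by rewrite Ec row0 b'r leqnn.
    by rewrite Ed // h1 // out oc.
  + move=> c oc; have nc : c != c0 by apply: contraNneq oc => ->.
    by rewrite Ed // h2 // out negb_and oc.
  + move=> c d oc od e le.
    have [dE|nd] := eqVneq d c0; have [cE|nc] := eqVneq c c0; first by rewrite dE cE.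
    * case/eqP: nc; apply: cell_inj; first by rewrite e dE.
      move: oc le; rewrite /outside e dE row0 col0 => ? ?.
      by apply/eqP; rewrite eqn_leq; apply/andP.
    * rewrite cE Ec Ed //; have /h1 : outside (add_cell nu r) d by rewrite out od.
      by rewrite -e cE row0 b'r; lia.
    * by rewrite !Ed // h3 // out ?oc ?od.
  + move=> c d oc od e lt.
    have [dE|nd] := eqVneq d c0; first by case: (above c) => //; rewrite -dE.
    have [cE|nc] := eqVneq c c0; last by rewrite !Ed // h4 // out ?oc ?od.
    rewrite cE Ec Ed //; have /h1 : outside (add_cell nu r) d by rewrite out od.
    by have := @b'_lt (cell_row d); rewrite -row0 -cE => /(_ lt); lia.
- apply/eqP/ffunP => c; rewrite !ffunE; have [->|nc] := eqVneq c c0; last by [].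
  by apply: val_inj; rewrite /= inordK // h2 // out eqxx andbF.
Qed.

Lemma tab_sum_peel :
  tab_sum nu b' =
    (if (0 < r)%N && (nu r.-1 == nu r) then 0
     else step_weight al be n t.+1 (nu r + n - r) * tab_sum (add_cell nu r) b')
    + tab_sum nu b.
Proof.
rewrite {1}/tab_sum (bigID (fun T : filling => T c0 == t.+1 :> nat)) /=.
rewrite [X in _ + X](eq_bigl _ _ valid_lower); congr (_ + _).
(* If rows r - 1 and r of nu have equal length, the cell above [c0] lies in mu/nu and would need an
   entry above t + 1. *)
case: ifPn => [/andP[r_gt0 /eqP nu_r]|nu_r].
  rewrite big_pred0 // => T; apply/negP => /andP[/validP[h1 _ _ h4] /eqP E].
  have [d dr dc] : exists2 d : cell, cell_row d = r.-1 & cell_col d = nu r.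
    apply: cell_ex; have := cellP c0; rewrite row0 col0.
    have := part_nonincr mu (leq_pred r); have := la_nu r.-1.
    lia.
  have od : outside nu d by rewrite /outside dr dc nu_r.
  have := h4 d c0 od out0; rewrite dc col0 dr row0 E => /(_ erefl).
  by have := h1 d od; have := b'_le (cell_row d); lia.
rewrite (reindex_onto (fun T => put T t.+1) (fun T => put T 0)) /=; last first.
  move=> T /andP[_ /eqP E]; apply/ffunP => c; rewrite !ffunE.
  by have [->|//] := eqVneq c c0; rewrite -E inord_val.
have Hr : (r = 0 \/ nu r < nu r.-1)%N.
  by have := nu_dec (leq_pred r); case: (r) nu_r => [|s] /=; lia.
rewrite mulr_sumr; apply: eq_big => [T|T vT].
  rewrite -(valid_raise _ Hr).
  have -> : put T t.+1 c0 == t.+1 :> nat by rewrite ffunE eqxx inordK.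
  by rewrite andbT.
rewrite (bigD1 c0) //= /cell_weight ffunE eqxx inordK // row0 col0; congr (_ * _).
apply: eq_big => [c|c /andP[_ /negbTE nc]]; first by rewrite (outside_add_cell _ row0 col0).
by rewrite ffunE nc.
Qed.

End Peel.

(** Row r of the matrix splits by [path_sum_succ]. If rows r - 1 and r of nu are equal, the advanced
    path r starts where path r - 1 does, with the same level bound, so two rows of the matrix
    agree. *)
Lemma path_det_peel nu b b' r t : (r < n)%N -> b r = t -> b' r = t.+1 ->
  (forall i, i != r -> b i = b' i) -> ((0 < r)%N -> b' r.-1 = t.+1) ->
  path_det nu b' =
    (if (0 < r)%N && (nu r.-1 == nu r) then 0
     else step_weight al be n t.+1 (nu r + n - r) * path_det (add_cell nu r) b')
    + path_det nu b.
Proof.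
move=> rn br b'r bb' b'pr; pose i0 := Ordinal rn.
have add_ne i : i != r -> add_cell nu r i = nu i.
  by rewrite /add_cell => /negbTE ->; rewrite addn0.
have lift_ne k : (lift i0 k : nat) != r by rewrite eq_sym; apply: (neq_lift i0 k).
have add_r : add_cell nu r r = (nu r).+1 by rewrite /add_cell eqxx addn1.
rewrite [LHS](@determinant_multilinear _ _ _
   (\matrix_(j < n, i < n) path_sum al be n (b' j) (add_cell nu r j + (n - j.+1))
      (part mu i + (n - i.+1)))
   (\matrix_(j < n, i < n) path_sum al be n (b j) (nu j + (n - j.+1))
      (part mu i + (n - i.+1)))
   i0 (step_weight al be n t.+1 (nu r + n - r)) 1); first last.
- by apply/matrixP => j i; rewrite !mxE bb' ?lift_ne.
- by apply/matrixP => j i; rewrite !mxE add_ne ?lift_ne.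
- apply/rowP => i; rewrite !mxE /= br b'r add_r path_sum_succ mul1r addSn.
  by have -> : ((nu r + (n - r.+1)).+1 = nu r + n - r)%N by lia.
rewrite mul1r; congr (_ + _); case: ifP => // /andP[r_gt0 /eqP nu_r].
have pn : (r.-1 < n)%N by lia.
rewrite (@determinant_alternate _ _ _ (Ordinal pn) i0) ?mulr0 //.
  by apply/eqP => /(congr1 val) /=; lia.
move=> i; rewrite !mxE /= b'pr // b'r add_r add_ne; last by lia.
by congr path_sum; lia.
Qed.

(** * Induction on levels and rows *)

Definition between nu :=
  [/\ forall i j, (i <= j)%N -> (nu j <= nu i)%N, forall i, (part la i <= nu i)%N &
      forall i, (nu i <= part mu i)%N].

(** Row r has no cell left to add: once path r is advanced, the starts 0, ..., r all lie strictly
    beyond the ends r, ..., n - 1. *)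
Lemma path_det_full nu b r : between nu -> (r < n)%N -> nu r = part mu r ->
  path_det (add_cell nu r) b = 0.
Proof.
move=> [nu_dec _ _] rn nu_r; apply: (det_zero_block rn) => j i jr ri.
rewrite mxE path_sum_gt // /add_cell.
have := part_nonincr mu ri; have := nu_dec _ _ jr; have := ltn_ord i.
by case: (eqVneq (j : nat) r) => [->|]; lia.
Qed.

Lemma between_add_cell nu r : between nu -> (nu r < part mu r)%N ->
  (r = 0 \/ nu r < nu r.-1)%N -> between (add_cell nu r).
Proof.
move=> [nu_dec la_nu nu_mu] lt nu_r; split=> [i j ij|i|i]; rewrite /add_cell.
- have := nu_dec _ _ ij; have [jr|jr] := eqVneq j r; last by lia.
  have [ir|ir] := eqVneq i r; first by rewrite ir jr.
  have /nu_dec : (i <= r.-1)%N by lia.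
  by rewrite jr; case: nu_r; lia.
- by have := la_nu i; lia.
- by have := nu_mu i; case: eqVneq => [->|]; lia.
Qed.

(* Levels are peeled off from the top and, within a level, from the last row to
   the first: only the rows before r may still use the level t + 1. *)
Definition level_bound t r i := minn (part la i + n) (t + (i < r))%N.

Hypotheses (la_mu : ptn_sub la mu) (mu_n : (ell mu <= n)%N).

Lemma path_det_tab_sum_step t r : (r < n)%N ->
  (forall nu, between nu -> path_det nu (level_bound t r) = tab_sum nu (level_bound t r)) ->
  forall nu, between nu ->
    path_det nu (level_bound t r.+1) = tab_sum nu (level_bound t r.+1).
Proof.
(* If t has reached the cap la_r + n, row r gains nothing from level t + 1. *)
move=> rn IHr; have [inactive|active] := leqP (part la r + n) t.
  have E i : level_bound t r.+1 i = level_bound t r i.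
    by rewrite /level_bound; case: (eqVneq i r) => [->|]; lia.
  move=> nu bt_nu; rewrite (path_det_eq nu (fun i _ => E i)) IHr //.
  by apply: tab_sum_eq => c _; rewrite E.
set b := level_bound t r in IHr *; set b' := level_bound t r.+1.
have br : b r = t by rewrite /b /level_bound; lia.
have b'r : b' r = t.+1 by rewrite /b' /level_bound; lia.
have bb' i : i != r -> b i = b' i by rewrite /b /b' /level_bound; lia.
(* As la is weakly decreasing, row r - 1 can use level t + 1 whenever row r can. *)
have b'pr : (0 < r)%N -> b' r.-1 = t.+1.
  by move=> _; have := part_nonincr la (leq_pred r); rewrite /b' /level_bound; lia.
(* Induction on the number of cells of mu/nu in row r: peeling either lowers the bound of this row
   or removes one of these cells. *)
move=> nu; move En: (part mu r - nu r)%N => k; elim: k nu En => [|k IHk] nu En bt_nu;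
  have [nu_dec la_nu nu_mu] := bt_nu; rewrite (path_det_peel nu rn br b'r bb' b'pr) IHr //.
  have nu_r : nu r = part mu r by have := nu_mu r; lia.
  rewrite path_det_full // mulr0 if_same add0r; apply: tab_sum_eq => c oc.
  apply: bb'; apply/eqP => cr; have := cellP c; move: oc.
  by rewrite /outside cr nu_r; lia.
have nu_lt : (nu r < part mu r)%N by lia.
have [c0 row0 col0] : exists2 c : cell, cell_row c = r & cell_col c = nu r.
  by apply: cell_ex; rewrite la_nu.
rewrite (tab_sum_peel nu_dec la_nu row0 col0 _ br b'r bb'); first last.
- by move=> i ri; rewrite /b' /level_bound; lia.
- by move=> i; rewrite /b' /level_bound; lia.
- by have := la_mu r; have := part_nonincr mu (leq0n r); lia.
congr (_ + _); case: ifPn => // nu_r; rewrite IHk //.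
  by rewrite /add_cell eqxx; lia.
apply: between_add_cell => //.
by have := nu_dec _ _ (leq_pred r); case: (r) nu_r => [|s] /=; lia.
Qed.

(** At level 0 no step can be taken: both sides are 1 if nu = mu and 0 otherwise. *)
Lemma path_det_tab_sum0 nu : between nu ->
  path_det nu (level_bound 0 0) = tab_sum nu (level_bound 0 0).
Proof.
move=> [nu_dec la_nu nu_mu]; have b0 i : level_bound 0 0 i = 0%N.
  by rewrite /level_bound ltn0 minn0.
rewrite /path_det; under eq_mx => j i do rewrite b0 path_sum0.
case: (boolP [exists i : 'I_n, nu i < part mu i]%N) => [/existsP ex|/existsPn full].
  have {ex} : exists i, (nu i < part mu i)%N by case: ex => i; exists (i : nat).
  (* For the first row i short of mu, column i is zero: earlier rows are full and start beyond end
     i, the others start before it. *)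
  case/ex_minnP => i lt_i min_i.
  have [c0 row0 col0] : exists2 c : cell, cell_row c = i & cell_col c = nu i.
    by apply: cell_ex; rewrite la_nu.
  have i_n : (i < n)%N by apply: leq_trans mu_n; rewrite -row0 row_lt.
  rewrite /tab_sum big_pred0 => [|T]; last first.
    apply/negP => /validP[h1 _ _ _]; have := h1 c0.
    by rewrite /outside row0 col0 b0 => /(_ (leqnn _)); lia.
  rewrite -det_tr (expand_det_row _ (Ordinal i_n)) big1 // => j _; rewrite !mxE /=.
  suff /negbTE -> : (nu j + (n - j.+1) != part mu i + (n - i.+1))%N by rewrite mul0r.
  have jn := ltn_ord j; have [ji|ij] := ltnP j i.
    have := part_nonincr mu (ltnW ji); have := nu_mu j; have := min_i j.
    by case: ltnP => [_ /(_ isT)|]; lia.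
  by have := nu_dec _ _ ij; lia.
have {}full i : nu i = part mu i.
  apply/eqP; rewrite eqn_leq nu_mu /=; have [i_n|n_i] := ltnP i n.
    by have := full (Ordinal i_n); rewrite -leqNgt.
  by rewrite part_default // (leq_trans mu_n).
have out c : outside nu c = false.
  by apply/negbTE; rewrite /outside full -ltnNge; case/andP: (cellP c).
transitivity (1 : R).
  rewrite -[RHS](det1 R n); congr (\det _); apply/matrixP => j i; rewrite !mxE full.
  congr (_%:R); have [->|ne] := eqVneq j i; first by rewrite eqxx.
  apply/eqP; have [ji|ij] := ltnP j i.
    by have := part_nonincr mu (ltnW ji); have := ltn_ord i; lia.
  have := part_nonincr mu ij; have := ltn_ord j.
  have : (i != j :> nat) by rewrite eq_sym.
  by lia.
rewrite /tab_sum (big_pred1 ([ffun=> ord0] : filling)) => [|T].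
  by rewrite big_pred0.
apply/validP/eqP => [[_ h2 _ _]|->]; last first.
  by split=> c; rewrite ?out // ffunE.
by apply/ffunP => c; apply: ord_inj; rewrite h2 ?out // ffunE.
Qed.

Lemma path_det_tab_sum t nu : between nu ->
  path_det nu (level_bound t 0) = tab_sum nu (level_bound t 0).
Proof.
elim: t nu => [|t IHt] nu bt_nu; first exact: path_det_tab_sum0.
suff H r : (r <= n)%N -> forall nu, between nu ->
    path_det nu (level_bound t r) = tab_sum nu (level_bound t r).
  (* Level t with all n rows allowed one more is level t + 1 with none. *)
  have E i : (i < n)%N -> level_bound t.+1 0 i = level_bound t n i.
    by rewrite /level_bound; lia.
  rewrite (path_det_eq nu E) H //; apply: tab_sum_eq => c _.
  by rewrite E // (leq_trans (row_lt c)).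
elim: r => [//|r IHr] rn; apply: path_det_tab_sum_step => //; exact: IHr (ltnW rn).
Qed.

End Tableaux.

(** * Inelegant tableaux *)

Section Coefficients.
Variables (R : comNzRingType) (al be : nat -> R) (la mu : ptn) (n : nat).

(** At level n + la_1 every row is at its cap la_j + n, and from there the start la_j + n - j - 1
    leaves exactly the alphabet A_(la_j) - B_j, with j counted from 0. *)
Lemma Ccoef_path_det :
  Ccoef n la mu al be =
    path_det mu n al be (part la) (level_bound la n (n + part la 0) 0).
Proof.
rewrite /Ccoef -det_tr; congr (\det _); apply/matrixP => j i; rewrite !mxE.
have -> : level_bound la n (n + part la 0) 0 j = (part la j + n)%N.
  by have := part_nonincr la (leq0n j); rewrite /level_bound; lia.
rewrite /path_sum addnK; have := ltn_ord i; have := ltn_ord j => jn i_n.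
congr (hpleth _ (AmB _ _ _ _)); first by lia.
by lia.
Qed.

(** If la_r > mu_r, the index of h is negative in all rows from r on and all columns up to r. *)
Lemma Ccoef_not_sub : (maxn (ell la) (ell mu) <= n)%N -> ~ ptn_sub la mu ->
  Ccoef n la mu al be = 0.
Proof.
move=> len /ptn_subP/forallPn[r0].
have r0n : (r0 < n)%N by have := ltn_ord r0; lia.
rewrite -ltnNge => lt_r; rewrite /Ccoef -det_tr.
apply: (det_zero_block r0n) => j i jr ri; rewrite !mxE /hpleth ifF //.
have := part_nonincr la jr; have := part_nonincr mu ri; lia.
Qed.

Hypotheses (la_mu : ptn_sub la mu) (mu_n : (ell mu <= n)%N).

Local Notation cell := (cell la mu).
Local Notation filling := {ffun cell -> 'I_(n + part mu 0).+1}.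

Definition unshift (t : filling) : {ffun cell -> int} := [ffun c => (t c : nat)%:Z - n%:Z].

Lemma unshiftE (t : filling) (c : cell) : unshift t c = (t c : nat)%:Z - n%:Z.
Proof. by rewrite ffunE. Qed.

Lemma unshift_inj : injective unshift.
Proof.
move=> t t' /ffunP E; apply/ffunP => c; apply: ord_inj.
by have := E c; rewrite !unshiftE => /addIr[].
Qed.

Lemma IET_unshift (T : {ffun cell -> int}) : is_IET T -> exists t, T = unshift t.
Proof.
rewrite -in_IET !inE mem_filter => /andP[_ /codomP[t0 ->]].
exists [ffun c : cell => inord (t0 c + (n - ell mu))%N]; apply/ffunP => c.
rewrite unshiftE !ffunE; have := ltn_ord (t0 c).
by move: (nat_of_ord (t0 c)) => k lt_k; rewrite inordK; lia.
Qed.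

Lemma perm_IET :
  perm_eq (IET la mu) [seq unshift t | t <- enum {: filling} & is_IET (unshift t)].
Proof.
apply: uniq_perm => [||T]; first exact: fset_uniq.
  by rewrite (map_inj_uniq unshift_inj) filter_uniq ?enum_uniq.
rewrite -/(T \in IET la mu) in_IET; apply/idP/mapP => [T_IET|[t]].
  by have [t Tt] := IET_unshift T_IET; exists t; rewrite // mem_filter -Tt T_IET mem_enum.
by rewrite mem_filter => /andP[? _] ->.
Qed.

Let b := level_bound la n (n + part la 0) 0.

Let bE i : b i = (part la i + n)%N.
Proof. by have := part_nonincr la (leq0n i); rewrite /b /level_bound; lia. Qed.

Let out_all (c : cell) : outside (part la) c.
Proof. by case/andP: (cellP c). Qed.

Lemma IET_valid (t : filling) : is_IET (unshift t) -> valid (part la) b t.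
Proof.
case/and3P => /forallP h1 /forallP h2 /forallP h3.
have hrow (c d : cell) : cell_row c = cell_row d -> (cell_col c <= cell_col d)%N -> (t d <= t c)%N.
  move=> e le; have /forallP/(_ d)/implyP := h1 c; rewrite !unshiftE => H.
  suff : (t d : nat)%:Z - n%:Z <= (t c : nat)%:Z - n%:Z by lia.
  by apply: H; rewrite /crow /ccol; apply/andP; split=> //; apply/eqP; congr _.+1.
have hcol (c d : cell) : cell_col c = cell_col d -> (cell_row c < cell_row d)%N -> (t d < t c)%N.
  move=> e lt; have /forallP/(_ d)/implyP := h2 c; rewrite !unshiftE => H.
  suff : (t d : nat)%:Z - n%:Z < (t c : nat)%:Z - n%:Z by lia.
  by apply: H; rewrite /crow /ccol; apply/andP; split=> //; apply/eqP; congr _.+1.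
have hbound (c : cell) :
    Num.min ((cell_col c).+1%:Z - (cell_row c).+1%:Z) 0 < (t c : nat)%:Z - n%:Z < (cell_col c).+1%:Z.
  by rewrite -unshiftE; apply: h3.
apply/validP; split=> [c _|c|c d _ _|c d _ _]; rewrite ?out_all //; first last.
- exact: hcol.
- exact: hrow.
(* The first cell of row i lies in column la_i + 1, where T < j reads T <= la_i; weak decrease
   carries this bound along the row. *)
have [c' row' col'] : exists2 c' : cell, cell_row c' = cell_row c &
    cell_col c' = part la (cell_row c).
  by apply: cell_ex; have := cellP c; lia.
have := hbound c; have := hbound c'; have := hrow c' c row'; have := row_lt c; have := cellP c.
rewrite bE col' row' !gt_min.
by move: (nat_of_ord (t c)) (nat_of_ord (t c')) => x y; lia.
Qed.

Lemma valid_IET (t : filling) : valid (part la) b t ->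
  [forall c, Num.min (content c) 0 < unshift t c] -> is_IET (unshift t).
Proof.
case/validP => h1 _ h3 h4 /forallP h; apply/and3P; split; apply/forallP => c.
- apply/forallP => d; apply/implyP => /andP[/eqP[e] le]; rewrite !unshiftE.
  by have := h3 c d (out_all c) (out_all d) e le; lia.
- apply/forallP => d; apply/implyP => /andP[/eqP[e] le]; rewrite !unshiftE.
  by have := h4 c d (out_all c) (out_all d) e le; lia.
- rewrite h /= unshiftE; have := h1 c (out_all c); rewrite bE.
  by have := out_all c; rewrite /outside /ccol -/(cell_col c); lia.
Qed.

(** Validity asks only for T > -n as a lower bound. A valid filling that is not inelegant has a cell
    of content c with T <= 0 and T - c <= 0, whose factor is zero by the convention on nonpositive
    indices. *)
Lemma IET_sum_tab_sum : IET_sum la mu al be = tab_sum la mu n al be (part la) b.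
Proof.
rewrite /IET_sum (perm_big _ perm_IET) /= big_map big_filter big_enum_cond /=.
rewrite /tab_sum big_mkcond [RHS]big_mkcond; apply: eq_bigr => t _ /=.
have factorE (c : cell) : ext0 al (unshift t c) - ext0 be (unshift t c - content c) =
    cell_weight al be t c.
  rewrite /cell_weight /step_weight unshiftE; congr (_ - ext0 _ _).
  have := row_lt c; rewrite /content /crow /ccol /cell_row /cell_col; lia.
case: ifPn => [t_IET|not_IET].
  by rewrite IET_valid //; apply: eq_big => c; rewrite ?out_all.
case: ifPn => // t_valid.
have /forallPn/= [c] : ~~ [forall c, Num.min (content c) 0 < unshift t c].
  by apply: contra not_IET; apply: valid_IET.
rewrite -leNgt le_min => /andP[Tc T0].
rewrite (bigD1 c) ?out_all //= -factorE /ext0 !ifF ?subrr ?mul0r //; lia.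
Qed.

Lemma Ccoef_IET_sum : Ccoef n la mu al be = IET_sum la mu al be.
Proof.
rewrite IET_sum_tab_sum Ccoef_path_det; apply: path_det_tab_sum => //.
by split=> // i j; apply: part_nonincr.
Qed.

End Coefficients.

Lemma Ccoef_indep (R : comNzRingType) (al be : nat -> R) la mu n n' :
  (maxn (ell la) (ell mu) <= n)%N -> (maxn (ell la) (ell mu) <= n')%N ->
  Ccoef n la mu al be = Ccoef n' la mu al be.
Proof.
move=> len len'; case: (ptn_subP la mu) => [sub|not_sub]; last by rewrite !Ccoef_not_sub.
by rewrite !Ccoef_IET_sum //; [move: len' | move: len]; rewrite geq_max => /andP[].
Qed.

(** * Bialternants *)

Section Action.
Variable R : comNzRingType.
Local Notation series := ({cmonom nat} -> R).
Implicit Types (k m : {cmonom nat}) (f g : series) (p q : {malg R[{cmonom nat}]}).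

(** * Action of polynomials on power series *)

Definition cm_dvd k m := mulcm k (divcm m k) == m.

Lemma cm_dvdP k m : reflect (forall i, (k i <= m i)%N) (cm_dvd k m).
Proof.
by apply: (iffP (cmP _ _)) => h i; have := h i; rewrite mulcmE divcmE; lia.
Qed.

Lemma divcm_mulcm k m : divcm (mulcm k m) k = m.
Proof. by apply/eqP/cmP => i; rewrite divcmE mulcmE; lia. Qed.

Definition mono_mul k g : series := fun m => if cm_dvd k m then g (divcm m k) else 0.

Lemma mono_mul_mulcm k g m : mono_mul k g (mulcm k m) = g m.
Proof.
rewrite /mono_mul ifT ?divcm_mulcm //; apply/cm_dvdP => i; rewrite mulcmE; lia.
Qed.

Lemma mono_mulA k1 k2 g m : mono_mul (mulcm k1 k2) g m = mono_mul k1 (mono_mul k2 g) m.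
Proof.
rewrite /mono_mul; have -> : divcm m (mulcm k1 k2) = divcm (divcm m k1) k2.
  by apply/eqP/cmP => i; rewrite !divcmE mulcmE; lia.
case: (cm_dvdP k1 m) => [h1|h1]; case: (cm_dvdP k2 (divcm m k1)) => [h2|h2];
  case: (cm_dvdP (mulcm k1 k2) m) => [h|h] //.
- by case: h => i; have := h1 i; have := h2 i; rewrite mulcmE divcmE; lia.
- by case: h2 => i; have := h i; rewrite mulcmE divcmE; lia.
- by case: h1 => i; have := h i; rewrite mulcmE; lia.
- by case: h1 => i; have := h i; rewrite mulcmE; lia.
Qed.

Definition pmul p g : series := fun m => \sum_(k <- msupp p) p@_k * mono_mul k g m.

Lemma pmulE p g m :
  pmul p g m = \sum_(k <- msupp p | mulcm k (divcm m k) == m) p@_k * g (divcm m k).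
Proof.
rewrite [RHS]big_mkcond; apply: eq_bigr => k _; rewrite /mono_mul /cm_dvd.
by case: ifP; rewrite ?mulr0.
Qed.

(** As an [mmap], the action is visibly additive in p and can be computed on monomials. *)
Lemma pmul_mmap p g m :
  pmul p g m = mmap [the {additive R -> R} of idfun]
    (fun k : {cmonom nat} => mono_mul k g m) p.
Proof. by []. Qed.

Lemma pmulM p q g m : pmul (p * q) g m = pmul p (pmul q g) m.
Proof.
rewrite pmul_mmap malgME raddf_sum /= [RHS]/pmul; apply: eq_bigr => k1 _.
rewrite raddf_sum /= {2}/mono_mul; under eq_bigr => k2 _ do
  rewrite mmapU /= -mulrA; rewrite -mulr_sumr; congr (_ * _).
under eq_bigr => k2 _ do rewrite mono_mulA {1}/mono_mul.
by case: ifP => _; [by [] | rewrite big1 // => k2 _; rewrite mulr0].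
Qed.

Lemma pmulU (c : R) k g m : pmul << c *g k >> g m = c * mono_mul k g m.
Proof. by rewrite pmul_mmap mmapU. Qed.

Lemma pmulU1 k g m : pmul << k >> g m = mono_mul k g m.
Proof. by rewrite -[RHS]mul1r -pmulU. Qed.

Lemma pmulB p q g m : pmul (p - q) g m = pmul p g m - pmul q g m.
Proof. by rewrite pmul_mmap mmapB. Qed.

Lemma pmul_binomial i j g m :
  pmul (<< @ucm nat i >> - << @ucm nat j >>) g m = mono_mul (ucm i) g m - mono_mul (ucm j) g m.
Proof. by rewrite pmulB; congr (_ - _); apply: pmulU1. Qed.

Lemma pmul1 g m : pmul 1 g m = g m.
Proof.
rewrite [LHS](pmulU1 (onecm _)) -[in LHS](mul0cm m); exact: mono_mul_mulcm.
Qed.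

Lemma pmul_lin p g (r : seq ptn) (c : ptn -> R) (h : ptn -> series) m :
  pmul p (fun m => g m - \sum_(nu <- r) c nu * h nu m) m =
    pmul p g m - \sum_(nu <- r) c nu * pmul p (h nu) m.
Proof.
have E k : mono_mul k (fun m => g m - \sum_(nu <- r) c nu * h nu m) m =
    mono_mul k g m - \sum_(nu <- r) c nu * mono_mul k (h nu) m.
  rewrite /mono_mul; case: ifP => // _.
  by rewrite sub0r big1 ?oppr0 // => nu _; rewrite mulr0.
rewrite /pmul; under eq_bigr => k _ do rewrite E mulrBr mulr_sumr.
rewrite sumrB exchange_big /=; congr (_ - _); apply: eq_bigr => nu _.
by rewrite mulr_sumr; apply: eq_bigr => k _; rewrite mulrCA.
Qed.

(* Cancellation of p, a form of degree e, localised to one degree d. *)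
Definition regular p e := forall f d,
  (forall m, mdeg m = (d + e)%N -> pmul p f m = 0) ->
  forall m, mdeg m = d -> f m = 0.

Lemma regular1 : regular 1 0.
Proof. by move=> f d h m md; have := h m; rewrite addn0 pmul1 => /(_ md). Qed.

Lemma regularM p q e e' : regular p e -> regular q e' -> regular (p * q) (e + e').
Proof.
move=> rp rq f d h; apply: (rq) => m md; apply: (rp _ (d + e')%N _ m md) => m' m'd.
by rewrite -pmulM h // m'd; lia.
Qed.

(* If (x_i - x_j) f = 0, the coefficient of f at m equals the one at m x_i / x_j,
   and it vanishes once x_j does not divide m. *)
Lemma regular_binomial i j : i != j -> regular (<< @ucm nat i >> - << @ucm nat j >>) 1.
Proof.
move=> ij f d h m; move Ee: (m j) => e; elim: e m Ee => [|e IH] m Ee md.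
all: have := h (mulcm (ucm i) m); rewrite pmul_binomial mono_mul_mulcm.
all: have -> : mdeg (mulcm (ucm i) m) = (d + 1)%N by rewrite mdegM mdegU md addnC.
all: move=> /(_ erefl)/eqP; rewrite subr_eq0 => /eqP ->; rewrite /mono_mul.
  rewrite ifF //; apply/negbTE/cm_dvdP => /(_ j).
  by rewrite mulcmE !ucmE Ee (negbTE ij) eqxx.
case: ifP => // /eqP E; apply: IH.
  by rewrite divcmE mulcmE !ucmE Ee (negbTE ij) eqxx; lia.
apply/eqP; rewrite -(eqn_add2l 1) -{1}(mdegU j) -mdegM /mmul /= E mdegM mdegU md.
by rewrite addnC.
Qed.

(** The degree of the Vandermonde product, and the size of delta = (n-1, ..., 0). *)
Definition stair n := (\sum_(i < n) (n - i.+1))%N.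

Definition vander n : {malg R[{cmonom nat}]} :=
  \prod_(i < n) \prod_(j < n | (i < j)%N) (<< @ucm nat i >> - << @ucm nat j >>).

Lemma regular_vander n : regular (vander n) (stair n).
Proof.
apply: (big_ind2 regular) => [|????|i _]; [exact: regular1 | exact: regularM |].
have -> : (n - i.+1 = \sum_(j < n | (i < j)%N) 1)%N.
  rewrite -(big_mkord (fun j => i < j)%N (fun=> 1%N)) (big_cat_nat (n := i.+1)) //=.
  rewrite big_nat_cond big_pred0 => [|j]; last by lia.
  rewrite add0n big_nat_cond (eq_bigl (fun j => (i.+1 <= j < n)%N)) => [|j]; last by lia.
  by rewrite -big_nat sum_nat_const_nat muln1.
apply: (big_ind2 regular) => [|????|j ij]; [exact: regular1 | exact: regularM |].
by apply: regular_binomial; rewrite neq_ltn ij.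
Qed.

(** * Alternants in finitely many variables *)

Definition in_vars n m := all (fun j => (j < n)%N) (finsupp m).

Lemma in_vars_bound m : in_vars (\max_(i <- finsupp m) i.+1) m.
Proof. by apply/allP => i im; apply: (@leq_bigmax_seq _ _ xpredT (fun i => i.+1) i im). Qed.

Lemma in_varsW n n' m : (n <= n')%N -> in_vars n m -> in_vars n' m.
Proof. by move=> nn /allP h; apply/allP => i /h /leq_trans; apply. Qed.

Lemma mdeg_in_vars n m : in_vars n m -> mdeg m = (\sum_(i < n) m i)%N.
Proof.
move=> h; rewrite mdegE -(big_mkord xpredT (fun i => m i)) /index_iota subn0.
rewrite [RHS](bigID (fun i => i \in finsupp m)) /= [X in (_ + X)%N]big1 ?addn0 => [|i]; last first.
  by rewrite -cmE_eq0 => /eqP.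
rewrite -[RHS]big_filter; apply: perm_big; apply: uniq_perm => [||i].
- exact: fset_uniq.
- by rewrite filter_uniq // iota_uniq.
rewrite mem_filter mem_iota /=; case: (boolP (i \in finsupp m)) => //= im.
by rewrite (allP h).
Qed.


Definition alt n (f : nat -> nat -> R) : series :=
  fun m => if in_vars n m then \det (\matrix_(i < n, j < n) f i (m (j : nat))) else 0.

Definition schur_exp (nu : ptn) n i d : R := (d == part nu i + (n - i.+1))%N%:R.

Definition G_exp la (al be : nat -> R) n i d : R :=
  hpleth (d%:Z - (part la i + (n - i.+1))%:Z) (AmB al be (part la i) i).

Definition sorts n m (nu : ptn) (s : 'S_n) :=
  forall i : 'I_n, m (s i) = (part nu i + (n - i.+1))%N.

(** A Leibniz term of the Schur alternant is, up to sign, a product of equality tests, nonzero only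
    for a permutation that sorts m into nu + delta. *)
Lemma alt_schur_neq0 n nu m : alt n (schur_exp nu n) m != 0 ->
  in_vars n m /\ exists s : 'S_n, sorts m nu s.
Proof.
rewrite /alt; case: ifP => [m_n|_]; last by rewrite eqxx.
have [/existsP[s /forallP sP] _|no_s] :=
    boolP [exists s : 'S_n, [forall i : 'I_n, m (s i) == part nu i + (n - i.+1)]%N].
  by split=> //; exists s => i; apply/eqP.
rewrite /determinant big1 ?eqxx // => s _.
have [i m_i] : exists i : 'I_n, (m (s i) != part nu i + (n - i.+1))%N.
  by apply/existsP; rewrite -negb_forall; apply: contra no_s => ?; apply/existsP; exists s.
by rewrite (bigD1 i) //= mxE /schur_exp (negbTE m_i) mul0r mulr0.
Qed.

(* The columns of the determinant at m are a permutation of those at nu + delta. *)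
Lemma det_sorts n m nu (s : 'S_n) (f : nat -> nat -> R) : sorts m nu s ->
  \det (\matrix_(i < n, j < n) f i (m (j : nat))) =
    \det (\matrix_(i < n, j < n) f i (part nu j + (n - j.+1))%N) * \det (perm_mx s : 'M[R]_n).
Proof.
move=> ms; rewrite -det_mulmx; congr (\det _).
have -> : perm_mx s = perm_mx ((s^-1)^-1)%g :> 'M[R]_n by rewrite invgK.
rewrite -col_permE; apply/matrixP => i j; rewrite !mxE; congr (f i _).
by rewrite -ms permKV.
Qed.

Lemma det_schur_exp nu n :
  \det (\matrix_(i < n, j < n) schur_exp nu n i (part nu j + (n - j.+1))%N) = 1.
Proof.
rewrite -[RHS](det1 R n); congr (\det _); apply/matrixP => i j; rewrite !mxE.
congr (_%:R); have [->|ne] := eqVneq i j; first by rewrite eqxx.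
apply/eqP; have [ji|ij] := ltnP j i.
  by have := part_nonincr nu (ltnW ji); have := ltn_ord i; lia.
have := part_nonincr nu ij; have := ltn_ord j.
by have : (i != j :> nat) by []; lia.
Qed.

(** In the index of h the n cancels, leaving the transpose of the matrix of [Ccoef]. *)
Lemma det_G_exp la al be nu n :
  \det (\matrix_(i < n, j < n) G_exp la al be n i (part nu j + (n - j.+1))%N) =
    Ccoef n la nu al be.
Proof.
rewrite -det_tr; congr (\det _); apply/matrixP => i j; rewrite !mxE /G_exp.
by congr hpleth; have := ltn_ord i; have := ltn_ord j; lia.
Qed.

End Action.

(** * Partitions from sorted exponents *)

Lemma ptn_eq (la mu : ptn) : (forall i, part la i = part mu i) -> la = mu.
Proof.
move=> E; apply: val_inj; apply: (@eq_from_nth _ 0%N) => [|i _]; last exact: E.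
have [||//] := ltngtP (size (val la)) (size (val mu)).
  by move=> /part_ell_gt0; rewrite -E part_default.
by move=> /part_ell_gt0; rewrite E part_default.
Qed.

Lemma ell_le_sumn (nu : ptn) : (ell nu <= sumn (val nu))%N.
Proof.
case/andP: (valP nu) => _; rewrite /ell; elim: (val nu) => //= x s IH.
by rewrite inE negb_or => /andP[x0 /IH]; lia.
Qed.

Lemma sumn_part n (nu : ptn) : (ell nu <= n)%N -> (\sum_(i < n) part nu i = sumn (val nu))%N.
Proof.
move=> nu_n; rewrite sumnE (big_nth 0%N) -(big_mkord xpredT (part nu)).
rewrite (big_cat_nat (n := ell nu)) //=.
suff -> : (\sum_(ell nu <= i < n) part nu i = 0)%N by rewrite addn0.
by rewrite big_nat big1 // => i /andP[/part_default].
Qed.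

Lemma mdeg_sorts n m nu (s : 'S_n) : (ell nu <= n)%N -> in_vars n m -> sorts m nu s ->
  mdeg m = (sumn (val nu) + stair n)%N.
Proof.
move=> nu_n m_n ms; rewrite (mdeg_in_vars m_n) (reindex_inj (@perm_inj _ s)) /=.
by rewrite -(sumn_part nu_n) /stair -big_split; apply: eq_bigr => i _; rewrite ms.
Qed.

Lemma geq_trans : transitive geq.
Proof. by move=> a b c /= ba ac; apply: leq_trans ba. Qed.

(** The sequence nu + delta is the decreasing rearrangement of the first n exponents of m, and a
    sorted list is determined by its multiset. *)
Lemma sorts_inj n m nu nu' (s s' : 'S_n) : (ell nu <= n)%N -> (ell nu' <= n)%N ->
  sorts m nu s -> sorts m nu' s' -> nu = nu'.
Proof.
move=> nu_n nu'_n ms ms'; pose a xi := [seq (part xi i + (n - i.+1))%N | i <- iota 0 n].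
have aE xi (r : 'S_n) : sorts m xi r -> perm_eq (a xi) [seq m i | i <- iota 0 n].
  move=> mr; rewrite -val_enum_ord /a -val_enum_ord -!map_comp.
  rewrite (eq_map (g := (fun i : 'I_n => m i) \o r)) => [|i /=]; last by rewrite mr.
  rewrite map_comp perm_map //; apply: uniq_perm => [||i].
  - by rewrite -enumT (map_inj_uniq (@perm_inj _ r)) enum_uniq.
  - by rewrite -enumT enum_uniq.
  - rewrite -enumT [RHS]mem_enum; apply/mapP; exists (r^-1%g i); first by rewrite mem_enum.
    by rewrite permKV.
have a_sorted xi : sorted geq (a xi).
  apply/(sortedP 0%N) => i; rewrite size_map size_iota => lt_i.
  rewrite !(nth_map 0%N) ?size_iota ?(ltnW lt_i) // !nth_iota ?(ltnW lt_i) // !add0n.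
  by have := part_nonincr xi (leqnSn i); rewrite /=; lia.
have E : a nu = a nu'.
  apply: (sorted_eq geq_trans) => //; first by move=> x y /=; lia.
  by rewrite (perm_trans (aE _ _ ms)) // perm_sym (aE _ _ ms').
apply: ptn_eq => i; have [i_n|n_i] := ltnP i n; last by rewrite !part_default //; lia.
have := congr1 (fun q => nth 0%N q i) E.
by rewrite !(nth_map 0%N) ?size_iota // nth_iota // add0n; lia.
Qed.

(** In a weakly decreasing list the zeros come last, so deleting them changes no value of [nth] with
    default 0. *)
Lemma ptn_of_seq (q : seq nat) : sorted geq q ->
  exists nu : ptn, (ell nu <= size q)%N /\ forall i, part nu i = nth 0%N q i.
Proof.
move=> q_sorted; pose p := [seq x <- q | x != 0%N].
have p_part : is_part p.
  by rewrite /is_part sorted_filter ?mem_filter //; apply: geq_trans.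
exists (exist _ p p_part : ptn); split; first by rewrite /ell size_filter count_size.
move=> i; rewrite /part /= {p_part}/p; elim: q q_sorted i => //= x q IH x_q i.
have q_sorted := path_sorted x_q; case: eqVneq => [x0|_]; last by case: i => //= i; apply: IH.
have {x_q} /allP q0 := order_path_min geq_trans x_q.
rewrite x0 in q0; have z j : nth 0%N q j = 0%N.
  have [/(mem_nth 0%N)/q0/=|] := ltnP j (size q); [by lia | exact: nth_default].
by rewrite IH // z x0; case: i => //= i; rewrite z.
Qed.

(** Distinct exponents sort into a strictly decreasing list, which dominates delta entrywise;
    subtracting delta leaves a weakly decreasing one. *)
Lemma sorts_ex n (m : {cmonom nat}) : injective (fun i : 'I_n => m i) ->
  exists nu : ptn, (ell nu <= n)%N /\ exists s : 'S_n, sorts m nu s.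
Proof.
move=> m_inj; pose t := [tuple m i | i < n]; pose a := sort geq t.
have a_t : perm_eq a t by rewrite perm_sort.
have a_size : size a = n by rewrite (perm_size a_t) size_tuple.
have a_sorted : sorted gtn a.
  rewrite gtn_sorted_uniq_geq (perm_uniq a_t) sort_sorted ?andbT.
    by rewrite map_inj_uniq ?enum_uniq.
  by move=> x y; rewrite /= leq_total.
have step i : (i.+1 < n)%N -> (nth 0 a i.+1 < nth 0 a i)%N.
  by rewrite -a_size => lt_i; have /(sortedP 0%N)/(_ _ lt_i) := a_sorted.
have low i : (i < n)%N -> (n - i.+1 <= nth 0 a i)%N.
  move En: (n - i.+1)%N => k; elim: k i En => // k IH i En i_n.
  by have := step i; have := IH i.+1; lia.
pose q := [seq (nth 0 a i - (n - i.+1))%N | i <- iota 0 n].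
have qE i : (i < n)%N -> nth 0%N q i = (nth 0 a i - (n - i.+1))%N.
  by move=> i_n; rewrite (nth_map 0%N) ?size_iota // nth_iota.
have q_sorted : sorted geq q.
  apply/(sortedP 0%N) => i; rewrite size_map size_iota => lt_i.
  by rewrite !qE ?(ltnW lt_i) //=; have := step i lt_i; lia.
have [nu [nu_q nuE]] := ptn_of_seq q_sorted; exists nu.
split; first by rewrite size_map size_iota in nu_q.
have [s sE] := tuple_permP a_t; exists s => i.
by rewrite nuE qE // subnK ?low // sE -tnth_nth !tnth_mktuple.
Qed.

(** * Schur expansion *)

Section AlternantExpansion.
Variable R : comNzRingType.

(** Two equal exponents of m give equal columns, so both sides vanish. Otherwise m sorts into a
    single nu + delta, only that term survives, and [det_sorts] gives both sides the same sign. The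
    degree condition puts this nu in the list. *)
Lemma alt_G_expansion n la (al be : nat -> R) (r : seq ptn) m : uniq r ->
  (forall nu, nu \in r -> (ell nu <= n)%N) ->
  (forall nu, (ell nu <= n)%N -> (sumn (val nu) + stair n)%N = mdeg m -> nu \in r) ->
  alt n (G_exp la al be n) m =
    \sum_(nu <- r) Ccoef n la nu al be * alt n (schur_exp R nu n) m.
Proof.
move=> r_uniq r_n r_all; rewrite /alt.
case: ifP => m_n; last by rewrite big1 // => nu _; rewrite mulr0.
have [m_inj|] := boolP (injectiveb (fun i : 'I_n => m i)); last first.
  move=> /injectivePn[i [j ij mij]].
  have det0 (f : nat -> nat -> R) : \det (\matrix_(i < n, j < n) f i (m (j : nat))) = 0.
    rewrite -det_tr; apply: (determinant_alternate ij) => k; rewrite !mxE.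
    by rewrite mij.
  by rewrite (det0 (G_exp la al be n)) big1 // => nu _; rewrite det0 mulr0.
have [nu [nu_n [s ms]]] := sorts_ex (injectiveP _ m_inj).
have nu_r : nu \in r by apply: r_all => //; rewrite (mdeg_sorts nu_n m_n ms).
rewrite (bigD1_seq nu) //= big_seq_cond big1 => [|nu' /andP[nu'_r ne]].
  by rewrite addr0 !(det_sorts _ ms) det_G_exp det_schur_exp mul1r.
apply/eqP; apply: contraNT ne => alt_neq0.
have [_ [s' ms']] : in_vars n m /\ exists s' : 'S_n, sorts m nu' s'.
  apply: (@alt_schur_neq0 R); rewrite /alt m_n; apply: contraNneq alt_neq0 => ->.
  by rewrite mulr0.
by apply/eqP; apply: (sorts_inj _ _ ms' ms) => //; apply: r_n.
Qed.

End AlternantExpansion.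

Lemma finite_bounded_seqs d k :
  exists r : seq (seq nat), forall s, (size s <= k)%N -> all (leq^~ d) s -> s \in r.
Proof.
elim: k => [|k [r IH]]; first by exists [:: [::]] => -[].
exists ([::] :: [seq x :: s | x <- iota 0 d.+1, s <- r]) => -[|x s]; first by rewrite mem_head.
rewrite ltnS => sk /andP[xd sd]; rewrite in_cons; apply/orP; right; apply/allpairsP; exists (x, s).
by rewrite mem_iota add0n ltnS /=; split=> //; apply: IH.
Qed.

Lemma finite_ptns d : exists S : {fset ptn}, forall nu : ptn, sumn (val nu) = d -> nu \in S.
Proof.
have [r rP] := finite_bounded_seqs d d.
exists [fset nu in pmap (fun s => insub s : option ptn) r]%fset => nu nu_d.
rewrite !inE /= mem_pmap_sub; apply: rP; first by rewrite -nu_d; apply: ell_le_sumn.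
by apply/allP => x x_nu; rewrite -nu_d sumnE (big_rem x x_nu) leq_addr.
Qed.

Section Expansion.
Variable R : comNzRingType.
Local Notation series := ({cmonom nat} -> R).

Definition restr n (g : series) : series := fun m => if in_vars n m then g m else 0.

Definition bialternant n0 (f : nat -> nat -> nat -> R) (g : series) :=
  forall n, (n0 <= n)%N -> forall m, pmul (vander R n) (restr n g) m = alt n (f n) m.

(** The alternant of nu lives in degree |nu| + [stair n], and cancelling the Vandermonde product
    lowers the degree by [stair n]. *)
Lemma schur_homogeneous nu (s : series) m : bialternant (ell nu) (schur_exp R nu) s ->
  mdeg m != sumn (val nu) -> s m = 0.
Proof.
move=> s_bialt ne; pose n := maxn (ell nu) (\max_(i <- finsupp m) i.+1).
have nu_n : (ell nu <= n)%N by apply: leq_maxl.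
have m_n : in_vars n m by apply: in_varsW (in_vars_bound m); apply: leq_maxr.
have <- : restr n s m = s m by rewrite /restr m_n.
apply: (@regular_vander R n _ (mdeg m)) => // m' m'_deg; rewrite s_bialt //.
apply/eqP; apply: contraNT ne => /alt_schur_neq0[m'_n [p m'p]].
by move: m'_deg; rewrite (mdeg_sorts nu_n m'_n m'p) => /addIn ->.
Qed.

Lemma G_schur_expansion la (al be : nat -> R) (s : ptn -> series) (g : series) (c : ptn -> R) :
  (forall n nu, (maxn (ell la) (ell nu) <= n)%N -> c nu = Ccoef n la nu al be) ->
  (forall nu, bialternant (ell nu) (schur_exp R nu) (s nu)) ->
  bialternant (ell la) (G_exp la al be) g ->
  forall m, exists S : {fset ptn}, forall S' : {fset ptn}, (S `<=` S')%fset ->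
    \sum_(nu <- S') c nu * s nu m = g m.
Proof.
move=> cE s_bialt g_bialt m; have [S SP] := finite_ptns (mdeg m); exists S => S' SS'.
(* Enough variables for m, for la, and for all partitions of size [mdeg m], whose length is at most
   their size. *)
pose n := maxn (maxn (ell la) (mdeg m)) (\max_(i <- finsupp m) i.+1).
have m_n : in_vars n m by apply: in_varsW (in_vars_bound m); apply: leq_maxr.
have la_n : (ell la <= n)%N by rewrite /n; lia.
pose r := [seq nu <- S' | sumn (val nu) == mdeg m].
have r_n nu : nu \in r -> (ell nu <= n)%N.
  rewrite mem_filter => /andP[/eqP nu_d _].
  by apply: leq_trans (ell_le_sumn nu) _; rewrite nu_d /n; lia.
have -> : \sum_(nu <- S') c nu * s nu m = \sum_(nu <- r) c nu * s nu m.
  rewrite (bigID (fun nu => sumn (val nu) == mdeg m)) /= big_filter.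
  rewrite [X in _ + X]big1 ?addr0 // => nu ne.
  by rewrite (schur_homogeneous (s_bialt nu)) ?mulr0 // eq_sym.
(* In degree [mdeg m] + [stair n], the product of [h] with the Vandermonde polynomial is zero by
   [alt_G_expansion]; cancelling that polynomial gives h m = 0. *)
pose h m' := restr n g m' - \sum_(nu <- r) c nu * restr n (s nu) m'.
suff : h m = 0.
  rewrite /h /restr m_n => /eqP; rewrite subr_eq0 => /eqP -> .
  by apply: eq_bigr => nu _.
apply: (@regular_vander R n h (mdeg m)) => // m' m'_deg.
rewrite pmul_lin g_bialt // (@alt_G_expansion R n la al be r m') ?filter_uniq ?fset_uniq //.
  apply/eqP; rewrite subr_eq0; apply/eqP; apply: eq_big_seq => nu /r_n nu_n.
  by rewrite s_bialt // (cE n) // geq_max la_n.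
move=> nu nu_n; rewrite m'_deg => /addIn nu_d; rewrite mem_filter nu_d eqxx.
exact: (fsubsetP SS' _ (SP nu nu_d)).
Qed.

End Expansion.

Lemma is_bialternantP n0 f (g : series) :
  is_bialternant n0 f g -> @bialternant params n0 f g.
Proof. by move=> gP n n0n m; rewrite pmulE; exact: (gP n n0n m). Qed.

(** * Nonnegativity of coefficients *)

Section Nonneg.
Local Notation P := {malg int[{cmonom (bool * nat)%type}]}.

Lemma nonneg_coefs0 : nonneg_coefs 0.
Proof. by move=> m; rewrite mcoeff0. Qed.

Lemma nonneg_coefsU (k : {cmonom (bool * nat)%type}) : nonneg_coefs << k >>.
Proof. by move=> m; rewrite mcoeffU1; case: (_ == _). Qed.

Lemma nonneg_coefsD (p q : P) : nonneg_coefs p -> nonneg_coefs q -> nonneg_coefs (p + q).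
Proof. by move=> hp hq m; rewrite mcoeffD addr_ge0. Qed.

Lemma nonneg_coefsM (p q : P) : nonneg_coefs p -> nonneg_coefs q -> nonneg_coefs (p * q).
Proof.
move=> hp hq m; rewrite mcoeffMl; apply: sumr_ge0 => k _; apply: sumr_ge0 => l _.
by rewrite mulrn_wge0 // mulr_ge0.
Qed.

End Nonneg.

(** Negating the betas turns each factor into alpha + beta, where either term may be zero by
    convention. *)
Lemma nonneg_IET_sum (la mu : ptn) : nonneg_coefs (IET_sum la mu alpha minus_beta).
Proof.
apply: (big_ind nonneg_coefs) => [||T _]; [exact: nonneg_coefs0 | exact: nonneg_coefsD |].
apply: (big_ind nonneg_coefs) => [||c _]; [exact: nonneg_coefsU | exact: nonneg_coefsM |].
rewrite /ext0 /minus_beta; apply: nonneg_coefsD.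
  by case: ifP => _; [exact: nonneg_coefsU | exact: nonneg_coefs0].
case: ifP => _; first by rewrite opprK; exact: nonneg_coefsU.
by rewrite oppr0; exact: nonneg_coefs0.
Qed.

Lemma nonneg_Ccoef (la mu : ptn) n : (maxn (ell la) (ell mu) <= n)%N ->
  nonneg_coefs (Ccoef n la mu alpha minus_beta).
Proof.
move=> len; have [sub|not_sub] := ptn_subP la mu.
  by rewrite Ccoef_IET_sum ?(leq_trans _ len) ?leq_maxr //; exact: nonneg_IET_sum.
by rewrite Ccoef_not_sub //; exact: nonneg_coefs0.
Qed.

Theorem theorem4p3 (la mu : ptn) (n : nat)
    (la_mu : ptn_sub la mu) (len : (maxn (ell la) (ell mu) <= n)%N) :
  Ccoef n la mu alpha beta = IET_sum la mu alpha beta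
  /\ (forall (s : ptn -> series) (g : series),
        (forall nu : ptn, is_schur nu (s nu)) ->
        is_G la alpha minus_beta g ->
        schur_positive s g)
  /\ nonneg_coefs (Ccoef n la mu alpha minus_beta).
Proof.
split; first by apply: Ccoef_IET_sum; rewrite ?(leq_trans _ len) ?leq_maxr.
split; last exact: nonneg_Ccoef.
move=> s g s_schur g_G.
(* The size of the determinant varies with nu; [Ccoef_indep] replaces it by a common one. *)
exists (fun nu => Ccoef (maxn (ell la) (ell nu)) la nu alpha minus_beta).
split; last by move=> nu; apply: nonneg_Ccoef.
apply: (@G_schur_expansion params la alpha minus_beta).
- by move=> n' nu len'; apply: Ccoef_indep.
- by move=> nu; apply: is_bialternantP; apply: s_schur.
- by apply: is_bialternantP; apply: g_G.
Qed.
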